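(* For every integer $k\ge2$, the family $\mathcal B_{2k}$ is infinite (contains infinitely many pairwise non-isomorphic graphs), and there is no finite family $\mathcal F_k$ of graphs such that $\mathcal A_{2k}=\operatorname{Forb}(\mathcal F_k)$.
   Context: All graphs are finite and simple. A signing of $G$ is a map $\sigma:E(G)\to\{+1,-1\}$; the sign of a cycle is the product of its edge signs, and the cycle is unbalanced if its sign is $-1$. $\mathcal A_{2k}$ is the family of graphs that admit a signing in which every $2k$-cycle is unbalanced. $\mathcal B_{2k}$ is the family of graphs that are subgraph-minimal outside $\mathcal A_{2k}$, i.e. graphs not in $\mathcal A_{2k}$ all of whose proper subgraphs are in $\mathcal A_{2k}$. For a family $\mathcal F$ of graphs, $\operatorname{Forb}(\mathcal F)$ is the family of graphs that contain no subgraph isomorphic to a member of $\mathcal F$. *)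

(* Defs.v *)
From HB Require Import structures.
From mathcomp Require Import all_boot all_order all_algebra.

Set Implicit Arguments.
Unset Strict Implicit.
Unset Printing Implicit Defensive.

Import Order.TTheory GRing.Theory Num.Theory.

Record sgraph := SGraph {
  vertex :> finType;
  adj : rel vertex;
  adj_sym : symmetric adj;
  adj_irrefl : irreflexive adj
}.

Definition edges (G : sgraph) : {set {set G}} :=
  [set e | [exists x, exists y, adj x y && (e == [set x; y])]].

Definition isomorphic (G H : sgraph) : Prop :=
  exists f : G -> H, bijective f /\ forall x y, adj (f x) (f y) = adj x y.

Record subgraph (G : sgraph) := Subgraph {
  sub_verts : {set G};
  sub_adj : rel G;
  sub_adj_sym : symmetric sub_adj;
  sub_adj_incl : subrel sub_adj (@adj G);
  sub_adj_verts : forall x y, sub_adj x y -> x \in sub_verts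
}.

Section GraphOfSubgraph.
Variables (G : sgraph) (S : subgraph G).

Definition subgraph_rel : rel {x : G | x \in sub_verts S} :=
  fun x y => sub_adj S (val x) (val y).

Lemma subgraph_rel_sym : symmetric subgraph_rel.
Proof. by move=> x y; apply: sub_adj_sym. Qed.

Lemma subgraph_rel_irrefl : irreflexive subgraph_rel.
Proof.
by move=> x; apply/negP => /(sub_adj_incl (s := S)); rewrite adj_irrefl.
Qed.

Definition graph_of_subgraph : sgraph :=
  SGraph subgraph_rel_sym subgraph_rel_irrefl.

End GraphOfSubgraph.

Coercion graph_of_subgraph : subgraph >-> sgraph.

Definition proper_subgraph (G : sgraph) (S : subgraph G) : Prop :=
  ~ (sub_verts S = [set: G] /\ sub_adj S =2 @adj G).

(* A signing is a total function on vertex sets; only its values on the edges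
   are constrained or used. *)
Definition signing (G : sgraph) (sigma : {set G} -> int) : Prop :=
  forall e, e \in edges G -> sigma e = 1%R \/ sigma e = (-1)%R.

(* A cycle is given by the cyclic list of its vertices. Lists of size at most 2
   can satisfy this predicate without being cycles of a simple graph, so it is
   meant for n >= 3. *)
Definition is_cycle (G : sgraph) (n : nat) (c : seq G) : Prop :=
  size c = n /\ ucycle (@adj G) c.

Definition cycle_sign (G : sgraph) (sigma : {set G} -> int) (c : seq G) : int :=
  (\prod_(x <- c) sigma [set x; next c x])%R.

Definition unbalanced (G : sgraph) (sigma : {set G} -> int) (c : seq G) : Prop :=
  cycle_sign sigma c = (-1)%R.

Definition graph_family := sgraph -> Prop.

Definition family_A (n : nat) : graph_family := fun G =>
  exists sigma : {set G} -> int,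
    signing sigma /\ forall c : seq G, is_cycle n c -> unbalanced sigma c.

Definition family_B (n : nat) : graph_family := fun G =>
  ~ family_A n G /\
  forall S : subgraph G, proper_subgraph S -> family_A n S.

Definition Forb (F : graph_family) : graph_family := fun G =>
  forall (H : sgraph) (S : subgraph G), F H -> ~ isomorphic S H.

(* Graphs are counted up to isomorphism in the next two definitions. *)
Definition finite_family (F : graph_family) : Prop :=
  exists (m : nat) (g : 'I_m -> sgraph),
    forall H, F H -> exists i, isomorphic H (g i).

Definition infinite_family (F : graph_family) : Prop :=
  exists g : nat -> sgraph,
    (forall i, F (g i)) /\ forall i j, i <> j -> ~ isomorphic (g i) (g j).

(* Main.v *)
(** The graphs that witness the theorem are quadrangulated tori whose vertical
    edges are subdivided.  With [q = k - 1], the vertices are the residues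
    modulo [q n], each [x] is joined to [x + 1], and the multiples [x] of [q]
    are joined to [x + q t].  For [t] and [n] large, the only cycles of length
    [2k = 2q + 2] are the [n] faces, each made of two paths of length [q] and
    two edges [x, x + q t] and [x + q, x + q + q t]: a closed walk of length
    [2k] has total displacement [0] in the universal cover, and once it enters
    a subdivided edge it must follow it to the end.  Every edge lies on exactly
    two faces, so the product of the signs of all faces is [1], and when [n] is
    odd they cannot all be [-1].  Conversely, alternating signs on the edges
    [x, x + q t], taken along [x, x + q, x + 2q, ...], make every face
    unbalanced except one, which can be any prescribed face; so deleting any
    edge brings the graph back into [A_2k].

    If [A_2k] were [Forb F] with [F] finite, every member of [B_2k] would
    contain a member of [F] as a subgraph, hence by minimality be isomorphic to
    it, so that [B_2k] would be finite up to isomorphism. *)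

Require Import Defs.
From mathcomp Require Import all_boot all_order all_algebra.
From mathcomp Require Import zify ring.
From Stdlib Require Import Classical.

Set Implicit Arguments.
Unset Strict Implicit.
Unset Printing Implicit Defensive.
Import Order.TTheory GRing.Theory Num.Theory.

(** * Cycles as periodic sequences *)

Lemma next_nth_mod (T : eqType) (x0 : T) (c : seq T) i :
  uniq c -> i < size c -> next c (nth x0 c i) = nth x0 c (i.+1 %% size c).
Proof.
case: c => [|x p] // Up lt_i; rewrite next_nth mem_nth // index_uniq //.
move: lt_i; rewrite ltnS leq_eqVlt => /predU1P[->|lt_i] /=.
  by rewrite modnn nth_default.
by rewrite modn_small //=; apply: set_nth_default.
Qed.

Lemma cycle_nthP (T : Type) (e : rel T) (x0 : T) (c : seq T) :
  reflect (forall i, i < size c -> e (nth x0 c i) (nth x0 c (i.+1 %% size c)))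
          (cycle e c).
Proof.
case: c => [|x p]; first by left.
apply: (iffP (pathP x0)); rewrite size_rcons => E i lt_i; have := E i lt_i.
  rewrite -rcons_cons !nth_rcons lt_i /=.
  move: lt_i; rewrite ltnS leq_eqVlt => /predU1P[->|lt_i].
    by rewrite ltnn eqxx modnn.
  by rewrite lt_i modn_small.
rewrite -rcons_cons !nth_rcons lt_i /=.
move: lt_i; rewrite ltnS leq_eqVlt => /predU1P[->|lt_i].
  by rewrite ltnn eqxx modnn.
by rewrite lt_i modn_small.
Qed.

Lemma cycle_sign_nth (G : sgraph) (sigma : {set G} -> int) (x0 : G) (c : seq G) :
  uniq c ->
  cycle_sign sigma c =
    (\prod_(i < size c) sigma [set nth x0 c i; nth x0 c (i.+1 %% size c)])%R.
Proof.
move=> Uc; rewrite /cycle_sign (big_nth x0) big_mkord.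
by apply: eq_bigr => i _; rewrite next_nth_mod.
Qed.

(** Sliding the window by one step trades [F m] for the equal [F (m + n)]. This lets a cycle be read
    from any starting vertex. *)
Lemma prod_periodic (R : comPzRingType) (F : nat -> R) n m :
  (forall i, F (i + n) = F i) ->
  (\prod_(i < n) F (m + i)%N = \prod_(i < n) F i)%R.
Proof.
move=> per; elim: m => // m <-; case: n per => [|n] per; first by rewrite !big_ord0.
rewrite big_ord_recr [RHS]big_ord_recl /= mulrC addn0.
rewrite [(m.+1 + n)%N]addSnnS per; congr (_ * _)%R.
by apply: eq_bigr => i _; rewrite /bump /= add1n addSnnS.
Qed.

(** * Infinite obstruction sets *)

Lemma iso_sym (G H : sgraph) : isomorphic G H -> isomorphic H G.
Proof.
case=> f [[f' fK f'K] adjf]; exists f'; split; first by exists f.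
by move=> x y; rewrite -adjf !f'K.
Qed.

Lemma iso_trans (G H L : sgraph) :
  isomorphic G H -> isomorphic H L -> isomorphic G L.
Proof.
case=> f [bf adjf] [g [bg adjg]]; exists (g \o f); split; first exact: bij_comp.
by move=> x y /=; rewrite adjg adjf.
Qed.

Definition whole (G : sgraph) : subgraph G :=
  @Subgraph G setT (@adj G) (@adj_sym G) (fun _ _ h => h) (fun x _ _ => in_setT x).

Lemma iso_spanning (G : sgraph) (S : subgraph G) :
  sub_verts S = setT -> sub_adj S =2 @adj G -> isomorphic S G.
Proof.
move=> VS ES; exists (fun x : S => val x); split; last by move=> x y; rewrite -ES.
have inS x : x \in sub_verts S by rewrite VS.
by exists (fun x => Sub x (inS x)) => x; [apply: val_inj | ].
Qed.

Lemma iso_whole (G : sgraph) : isomorphic (whole G) G.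
Proof. exact: iso_spanning. Qed.

Lemma infinite_not_Forb n (F : graph_family) :
  infinite_family (family_B n) -> finite_family F ->
  ~ (forall G, family_A n G <-> Forb F G).
Proof.
case=> G [BG nisoG] [m [g Fg]] AF.
(* Pigeonhole: [m.+1] members of the infinite family against [m] representatives. *)
have isoG (i : 'I_m.+1) : exists j, isomorphic (G i) (g j).
  have [nA minG] := BG i; have nForb : ~ Forb F (G i) by move/AF.
  have [H [S [FH SH]]] : exists H, exists S : subgraph (G i), F H /\ isomorphic S H.
    apply: NNPP => none; apply: nForb => H S FH SH; apply: none; by exists H, S.
  have [j Hj] := Fg H FH; exists j.
  (* [S] contains a copy of [H], namely itself as [whole S], so it lies outside [family_A n];
     minimality of [G i] then forces [S] to be all of [G i]. *)
  have nAS : ~ family_A n S.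
    by move/AF/(_ H (whole S) FH); apply; apply: iso_trans (iso_whole S) SH.
  have [VS ES] : sub_verts S = setT /\ sub_adj S =2 @adj (G i).
    by apply: NNPP => /minG.
  by apply: iso_trans Hj; apply: iso_trans SH; apply/iso_sym/iso_spanning.
have [f isof] := fin_all_exists isoG.
have /injectivePn[i [j neq_ij eq_f]] : ~~ injectiveb f.
  apply/negP => /injectiveP/leq_card; apply/negP; by rewrite -ltnNge !card_ord.
apply: (nisoG i j); first by apply/eqP.
by apply: iso_trans (isof i) _; rewrite eq_f; apply: iso_sym.
Qed.

(** * Closed walks in the grid *)

Local Open Scope ring_scope.

(* A step of a walk, as its (vertical, horizontal) displacement in the universal
   cover of the torus. *)
Definition unit_step (s : int * int) :=
  s \in [:: (1, 0); (-1, 0); (0, 1); (0, -1)].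

Lemma unit_stepP s : unit_step s ->
  s.1 = 1 /\ s.2 = 0 \/ s.1 = -1 /\ s.2 = 0 \/
  s.1 = 0 /\ s.2 = 1 \/ s.1 = 0 /\ s.2 = -1.
Proof.
by rewrite /unit_step !inE => /or4P[]/eqP->; tauto.
Qed.

(** The defects [1 - w i] are nonnegative and sum to zero. *)
Lemma sum_eq_natz n (w : nat -> int) :
  (forall i, w i <= 1) -> \sum_(i < n) w i = n%:Z ->
  forall i, (i < n)%N -> w i = 1.
Proof.
move=> w_le1 Ew i lt_in; apply/eqP; rewrite eq_sym -subr_eq0; apply/eqP.
apply: (psumr_eq0P (P := predT) (F := fun j : 'I_n => 1 - w j) _ _
  (i := Ordinal lt_in)) => //.
  by move=> j _; rewrite subr_ge0.
by rewrite sumrB Ew sumr_const card_ord; lia.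
Qed.

Lemma sum_le_natz n (w : nat -> int) :
  (forall i, w i <= 1) -> \sum_(i < n) w i <= n%:Z.
Proof.
move=> w_le1; apply: (@le_trans _ _ (\sum_(i < n) 1)); first exact: ler_sum.
by rewrite sumr_const card_ord; lia.
Qed.

(** Two consecutive parallel unit steps that are not opposite are equal. *)
Lemma no_backtrack_constant (s : nat -> int * int) n :
  (forall i, unit_step (s i)) -> (forall i, s i.+1 <> - s i) ->
  ((forall i, (i < n)%N -> (s i).2 = 0) ->
     forall i, (i < n)%N -> (s i).1 = (s 0%N).1) /\
  ((forall i, (i < n)%N -> (s i).1 = 0) ->
     forall i, (i < n)%N -> (s i).2 = (s 0%N).2).
Proof.
move=> unit_s nb; split=> s0; elim=> // i IH lt_in.
  rewrite -IH ?(ltnW lt_in) //; have := nb i.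
  have [] := (s0 _ lt_in, s0 _ (ltnW lt_in)).
  have:= unit_stepP (unit_s i); have := unit_stepP (unit_s i.+1).
  case: (s i) (s i.+1) => [a b] [c d] /= H1 H2 e1 e2; rewrite e1 e2 => H.
  have : c <> - a by move=> E; apply: H; rewrite E.
  lia.
rewrite -IH ?(ltnW lt_in) //; have := nb i.
have [] := (s0 _ lt_in, s0 _ (ltnW lt_in)).
have:= unit_stepP (unit_s i); have := unit_stepP (unit_s i.+1).
case: (s i) (s i.+1) => [a b] [c d] /= H1 H2 e1 e2; rewrite e1 e2 => H.
have : d <> - b by move=> E; apply: H; rewrite E.
lia.
Qed.

(** The four factors are the sides of a face: a run of [q] steps, a crossing, a run back, and the
    closing step. *)
Lemma big_two_runs (R : Type) (idx : R) (op : Monoid.law idx) q (F : nat -> R) :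
  \big[op/idx]_(i < q.*2.+2) F i =
  op (op (\big[op/idx]_(i < q) F i)
         (op (F q) (\big[op/idx]_(i < q) F (q.+1 + i)%N)))
     (F q.*2.+1).
Proof.
rewrite big_ord_recr /=; congr (op _ _).
have -> : q.*2.+1 = (q + q.+1)%N by lia.
rewrite big_split_ord /= big_ord_recl /= addn0; congr (op _ (op _ _)).
by apply: eq_bigr => i _; rewrite /bump /= add1n addSnnS.
Qed.

(* Once the first [q] steps are all [(e, 0)], the other [q + 1] steps before the
   last must have vertical displacement [- q e] in total, and the first of them
   cannot be [(- e, 0)]; so it is horizontal and the others are [(- e, 0)]. *)
Lemma closed_walk_rigid q (s : nat -> int * int) (e : int) :
  (0 < q)%N ->
  (forall i, unit_step (s i)) -> (forall i, s i.+1 <> - s i) ->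
  \sum_(i < q.*2.+2) (s i).1 = 0 ->
  (forall i, (i < q)%N -> s i = (e, 0)) -> (s q.*2.+1).1 = 0 ->
  (s q).1 = 0 /\ forall i, (i < q)%N -> s (q.+1 + i)%N = (- e, 0).
Proof.
move=> q0 unit_s nb sum1 s_start s_end.
have e_unit : e = 1 \/ e = -1.
  by have := unit_stepP (unit_s 0%N); rewrite s_start //=; lia.
have start_sum : \sum_(i < q) (s i).1 = q%:Z * e.
  rewrite (eq_bigr (fun=> e)) => [|i _]; last by rewrite s_start.
  by rewrite sumr_const card_ord -mulr_natl natz.
move: sum1; rewrite (big_two_runs _ _ (fun i => (s i).1)) /= start_sum s_end.
rewrite addr0 => sum1.
(* Progress of a step of the second run in the direction opposite to [e]. *)
pose w i := - e * (s (q.+1 + i)%N).1.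
have w_le1 i : w i <= 1.
  by rewrite /w; have := unit_stepP (unit_s (q.+1 + i)%N); case: e_unit => ->; lia.
have w_sum : \sum_(i < q) w i = - e * \sum_(i < q) (s (q.+1 + i)%N).1.
  by rewrite mulr_sumr.
have w_bound := sum_le_natz q w_le1.
(* A vertical step here would have to be [(e, 0)], leaving a distance of [q + 1] to undo in [q]
   steps. *)
have sq0 : (s q).1 = 0.
  have := nb q.-1; rewrite prednK // (s_start q.-1) ?prednK //.
  have := unit_stepP (unit_s q); case: (s q) sum1 => a b /= sum1 Hab nab.
  have nae : a <> - e by move=> E; apply: nab; rewrite E; have -> : b = 0 by lia.
  move: sum1 w_sum w_bound; set X := \sum_(i < q) _; set Y := \sum_(i < q) _.
  by case: e_unit nae => -> nae; lia.
have w_eq : forall i, (i < q)%N -> w i = 1.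
  apply: sum_eq_natz => //; rewrite w_sum; move: sum1; rewrite sq0.
  by set X := \sum_(i < q) _; case: e_unit => ->; lia.
have s_back i : (i < q)%N -> s (q.+1 + i)%N = (- e, 0).
  move=> /w_eq; rewrite /w; have := unit_stepP (unit_s (q.+1 + i)%N).
  case: (s _) => a b /=; case: e_unit => -> Hab Eab; congr (_, _); lia.
by [].
Qed.

(** * Subdivided toroidal grids *)

Section Torus.

Variables q t n : nat.
Hypothesis q_gt0 : (0 < q)%N.
Hypothesis t_big : (q.*2.+2 < t)%N.
Hypothesis n_big : (q.*2.+2 * (q * t).+1 < n)%N.

Local Notation r := (q * t)%N.
Local Notation N := (q * n)%N.
Local Notation V := 'Z_N.

(** * Residues modulo [q * n] and branch vertices *)

Lemma n_le_N : (n <= N)%N.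
Proof. by rewrite leq_pmull. Qed.

Lemma N_gt1 : (1 < N)%N.
Proof. by rewrite (leq_trans _ n_le_N) //; move: n_big; lia. Qed.

Lemma ltn_V (x : V) : (x < N)%N.
Proof. by rewrite -[ltnRHS](Zp_cast N_gt1) ltn_ord. Qed.

Lemma intZ_eq0 (z : int) : (`|z| < N)%N -> z%:~R = 0 :> V -> z = 0.
Proof.
move=> lt_z z0; have : `|z|%N%:R = 0 :> V.
  case: z {lt_z} z0 => z; first by rewrite -pmulrn.
  by rewrite NegzE mulrNz -pmulrn => /eqP; rewrite oppr_eq0 abszN => /eqP.
move/(congr1 (fun x : V => nat_of_ord x)); rewrite /= val_Zp_nat ?N_gt1 //.
by rewrite modn_small //; lia.
Qed.

Definition branch (x : V) := (q %| x)%N.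

(** Divisibility by [q] survives reduction modulo [q * n]. *)
Lemma branch_natD (x : V) m : branch (x + m%:R) = (q %| x + m)%N.
Proof.
rewrite /branch -{1}(natr_Zp x) -natrD val_Zp_nat ?N_gt1 //.
by rewrite /dvdn modn_dvdm // dvdn_mulr.
Qed.

Lemma branchD (x : V) (z : int) : branch x -> branch (x + z%:~R) = (q %| `|z|)%N.
Proof.
move=> bx; case: z => m; first by rewrite -pmulrn branch_natD dvdn_addr.
rewrite NegzE mulrNz -pmulrn abszN.
set y := x - _; have Ey : x = y + m.+1%:R by rewrite subrK.
move: bx; rewrite Ey branch_natD => bx.
apply/idP/idP => h; first by rewrite -(dvdn_addr _ h).
by rewrite /branch -(dvdn_addl _ h).
Qed.

Lemma branchDr (x : V) : branch x -> branch (x + r%:R).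
Proof. by move=> bx; rewrite pmulrn branchD // dvdn_mulr. Qed.

Definition torus_rel (x y : V) :=
  [|| y == x + 1, x == y + 1, branch x && (y == x + r%:R)
    | branch y && (x == y + r%:R)].

Lemma torus_sym : symmetric torus_rel.
Proof.
by move=> x y; rewrite /torus_rel orbCA; congr [|| _, _ | _]; rewrite orbC.
Qed.

Lemma r_lt_N : (r < N)%N.
Proof. apply: leq_trans n_le_N; move: n_big; nia. Qed.

Lemma torus_irrefl : irreflexive torus_rel.
Proof.
have nz (z : int) (x : V) : (0 < `|z| < N)%N -> x == x + z%:~R = false.
  case/andP => z0 zN; apply/eqP => /eqP; rewrite eq_sym -subr_eq0 addrAC subrr add0r.
  by move/eqP/(intZ_eq0 zN); move: z0; lia.
move=> x; rewrite /torus_rel -[1]/(1%:~R) [r%:R]pmulrn !nz ?andbF //=.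
  by rewrite r_lt_N muln_gt0 q_gt0 (leq_ltn_trans _ t_big).
exact: N_gt1.
Qed.

Definition torus := SGraph torus_sym torus_irrefl.

(** * Closed walks on the torus *)

(* Meaningful only on adjacent vertices: every other pair gets [(0, -1)]. *)
Definition direction (x y : V) : int * int :=
  if y == x + 1 then (1, 0) else if x == y + 1 then (-1, 0)
  else if branch x && (y == x + r%:R) then (0, 1) else (0, -1).

Lemma directionP (x y : V) (s := direction x y) : torus_rel x y ->
  [/\ unit_step s, y = x + s.1%:~R + r%:R * s.2%:~R
    & s.2 <> 0 -> branch x /\ branch y].
Proof.
rewrite /torus_rel /s /direction.
case: eqP => [->|_] /=; first by split=> //; ring.
case: eqP => [->|_] /=; first by split=> //; ring.
case: ifP => [/andP[bx /eqP->] _|_] /=.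
  by split=> // [|_]; [ring | split=> //; apply: branchDr].
by case/andP=> bx /eqP->; split=> // [|_]; [ring | split=> //; apply: branchDr].
Qed.

(** A cycle enters as a periodic walk without backtracking. Somewhere a horizontal step is followed
    by a vertical one; the vertex between them is a branch vertex, the walk is forced straight on
    for [q] steps, and [closed_walk_rigid] fixes the rest. *)
Lemma closed_torus_walk (f : nat -> V) :
  (forall i, f (i + q.*2.+2)%N = f i) -> (forall i, torus_rel (f i) (f i.+1)) ->
  (forall i, f i.+2 <> f i) ->
  exists m (x : V) (e d : int),
    [/\ branch x, e = 1 \/ e = -1, d = 1 \/ d = -1,
        forall j, (j <= q)%N -> f (m + j)%N = x + (e * j%:Z)%:~R
      & forall j, (j <= q)%N ->
          f (m + (q.+1 + j))%N = x + (e * (q%:Z - j%:Z))%:~R + r%:R * d%:~R].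
Proof.
set K := q.*2.+2; move=> per adj_f nb_f.
pose s i := direction (f i) (f i.+1).
have unit_s i : unit_step (s i) by have [] := directionP (adj_f i).
have fS i : f i.+1 = f i + (s i).1%:~R + r%:R * (s i).2%:~R.
  by have [] := directionP (adj_f i).
have branch_s i : (s i).2 <> 0 -> branch (f i) /\ branch (f i.+1).
  by have [] := directionP (adj_f i).
have nb i : s i.+1 <> - s i.
  by move=> E; apply: (nb_f i); rewrite (fS i.+1) (fS i) E /= !mulrNz; ring.
have per_s i : s (i + K)%N = s i by rewrite /s -addSn !per.
have telescope m k : f (m + k)%N =
    f m + (\sum_(i < k) (s (m + i)%N).1)%:~R
        + r%:R * (\sum_(i < k) (s (m + i)%N).2)%:~R.
  elim: k => [|k IH]; first by rewrite !big_ord0 addn0; ring.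
  by rewrite addnS fS IH !big_ord_recr /= !intrD; ring.
have sum_bound (F : nat -> int) :
    (forall i, `|F i| <= 1) -> `|\sum_(i < K) F i| <= K%:Z.
  move=> F1; apply: le_trans (ler_norm_sum _ _ _) _.
  apply: (@le_trans _ _ (\sum_(i < K) 1)); first exact: ler_sum.
  by rewrite sumr_const card_ord; lia.
have sums0 m : \sum_(i < K) (s (m + i)%N).1 = 0 /\ \sum_(i < K) (s (m + i)%N).2 = 0.
  have := telescope m K; rewrite per -addrA => /eqP.
  rewrite eq_sym -subr_eq0 addrAC subrr add0r.
  have : `|\sum_(i < K) (s (m + i)%N).1| <= K%:Z.
    apply: (sum_bound (fun i => (s (m + i)%N).1)) => i.
    by have := unit_stepP (unit_s (m + i)%N); lia.
  have : `|\sum_(i < K) (s (m + i)%N).2| <= K%:Z.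
    apply: (sum_bound (fun i => (s (m + i)%N).2)) => i.
    by have := unit_stepP (unit_s (m + i)%N); lia.
  set b := \sum_(i < K) _; set a := \sum_(i < K) _ => b_le a_le.
  (* The bound [K * (r + 1) < n] turns the congruence for [a + r * b] into an equality of integers;
     then [|a| <= K < r] forces [b = 0]. *)
  have r_gtK : (K < r)%N by move: t_big; rewrite -/K; nia.
  rewrite pmulrn -intrM -intrD => /eqP/intZ_eq0.
  have lt_N : (`|(a + r%:Z * b)%R| < N)%N.
    apply: leq_trans n_le_N; apply: leq_ltn_trans n_big; rewrite -/K; nia.
  move=> /(_ lt_N) ab0; have b0 : b = 0 by nia.
  by move: ab0; rewrite b0; lia.
(* If all steps were horizontal, they would be equal and add up to [K] or [- K], not to 0. The same
   argument then yields a horizontal step. *)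
have [i0 v_i0] : exists i, (s i).1 != 0.
  have [/existsP[i v_i]|] := boolP [exists i : 'I_K, (s i).1 != 0]; first by exists i.
  rewrite negb_exists => /forallP s0.
  have [_ s_const] := no_backtrack_constant K unit_s nb.
  have {}s0 i : (i < K)%N -> (s i).1 = 0.
    by move=> lt_i; apply/eqP; have := s0 (Ordinal lt_i); rewrite negbK.
  have [_] := sums0 0%N; rewrite (eq_bigr (fun=> (s 0%N).2)) => [|i _].
    rewrite sumr_const card_ord; have := unit_stepP (unit_s 0%N).
    by have := s0 0%N isT; lia.
  by rewrite add0n s_const.
have [i1 h_i1] : exists i, (s i).1 = 0.
  have [/existsP[i /eqP v_i]|] := boolP [exists i : 'I_K, (s i).1 == 0].
    by exists i.
  rewrite negb_exists => /forallP s0.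
  have [s_const _] := no_backtrack_constant K unit_s nb.
  have {}s0 i : (i < K)%N -> (s i).2 = 0.
    move=> lt_i; have /= := s0 (Ordinal lt_i).
    by have := unit_stepP (unit_s i); lia.
  have [+ _] := sums0 0%N; rewrite (eq_bigr (fun=> (s 0%N).1)) => [|i _].
    rewrite sumr_const card_ord; have := unit_stepP (unit_s 0%N).
    by have := s0 0%N isT; lia.
  by rewrite add0n s_const.
have [m v_m h_m] : exists2 m, (s m.+1).1 != 0 & (s m).1 = 0.
  have ex : exists m, (s (i1 + m)%N).1 != 0.
    (* Starting from [i1], this reaches [i0 + i1 * K], a translate of [i0] by whole periods. *)
    exists (i0 + i1 * K.-1)%N.
    rewrite (_ : (_ + _)%N = (i0 + i1 * K)%N); last by rewrite /K; lia.
    by elim: (i1) => [|i IH]; rewrite ?addn0 // mulSn addnCA addnC per_s.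
  case: (ex_minnP ex) => -[|m] v_m min_m; first by move: v_m; rewrite addn0 h_i1.
  exists (i1 + m)%N; first by rewrite -addnS.
  apply/eqP/negPn/negP => /min_m; lia.
have s_m2 : (s m).2 <> 0 by have := unit_stepP (unit_s m); lia.
have [_ b_m] := branch_s m s_m2.
set e := (s m.+1).1 in v_m.
(* At a distance strictly between 0 and [q] from the branch vertex [f m.+1] there is no branch
   vertex, so the walk cannot turn. *)
have s_start : forall j, (j < q)%N -> s (m.+1 + j)%N = (e, 0).
  move=> j; elim/ltn_ind: j => j IH lt_jq; rewrite [LHS]surjective_pairing.
  case: j IH lt_jq => [|j] IH lt_jq.
    rewrite addn0; congr (_, _).
    by have := unit_stepP (unit_s m.+1); move: v_m; rewrite /e; lia.
  have sj : s (m.+1 + j)%N = (e, 0) by apply: IH; lia.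
  have := nb (m.+1 + j)%N; rewrite sj -addnS.
  have h0 : (s (m.+1 + j.+1)%N).2 = 0.
    apply/eqP/negPn/negP => /eqP /branch_s[+ _]; apply/negP.
    rewrite telescope.
    rewrite (eq_bigr (fun=> e)) => [|i _]; last by rewrite IH //; case: i => /=; lia.
    rewrite [X in _ * X%:~R]big1 => [|i _]; last by rewrite IH //; case: i => /=; lia.
    rewrite mulr0z mulr0 addr0 branchD // sumr_const card_ord.
    apply/negP => /dvdnP [k Ek].
    have e1 : e = 1 \/ e = -1 by have := unit_stepP (unit_s m.+1); rewrite -/e; lia.
    have : k = 0%N \/ (0 < k)%N by lia.
    by case: e1 Ek => ->; nia.
  have := unit_stepP (unit_s (m.+1 + j.+1)%N).
  have e1 : e = 1 \/ e = -1 by have := unit_stepP (unit_s m.+1); rewrite -/e; lia.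
  move: h0; case: (s _) => a b /= -> Ha nab; congr (_, _).
  have : a <> - e by move=> E; apply: nab; rewrite E.
  by lia.
have [sum1 _] := sums0 m.+1.
(* The window starts at [m.+1], so its last step is step [m], one period later. *)
have s_last0 : (s (m.+1 + q.*2.+1)%N).1 = 0.
  by rewrite (_ : (m.+1 + q.*2.+1)%N = (m + K)%N) ?per_s // /K; lia.
have nb_m i : s (m.+1 + i.+1)%N <> - s (m.+1 + i)%N by rewrite addnS; apply: nb.
have [sq1 s_back] := closed_walk_rigid (s := fun i => s (m.+1 + i)%N)
  q_gt0 (fun i => unit_s _) nb_m sum1 s_start s_last0.
have e1 : e = 1 \/ e = -1 by have := unit_stepP (unit_s m.+1); rewrite -/e; lia.
have f_start j : (j <= q)%N -> f (m.+1 + j)%N = f m.+1 + (e * j%:Z)%:~R.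
  elim: j => [|j IH] lt_jq; first by rewrite addn0 mulr0 addr0.
  rewrite addnS fS IH ?(ltnW lt_jq) // s_start //= intS mulrDr mulr1 !intrD; ring.
exists m.+1, (f m.+1), e, (s (m.+1 + q)%N).2; split=> //.
  by have := unit_stepP (unit_s (m.+1 + q)%N); lia.
elim=> [|j IH] lt_jq.
  by rewrite addn0 subr0 addnS fS f_start // sq1; ring.
rewrite addnS addnS fS IH ?(ltnW lt_jq) // s_back //= intS opprD !mulrDr !intrD; ring.
Qed.

Lemma branchD_q (x : V) : branch x -> branch (x + q%:R).
Proof. by move=> bx; rewrite pmulrn branchD //=. Qed.

(** The relation [E] will be the adjacency of a subgraph. The witness [z] is the corner from which
    the face extends by [q] and by [r]; vertical edges have sign 1, so only the two horizontal edges
    contribute. *)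
Lemma closed_torus_walk_face (sigma : {set V} -> int) (E : rel V) (f : nat -> V) :
  symmetric E -> subrel E torus_rel -> (forall x, sigma [set x; x + 1] = 1) ->
  (forall i, f (i + q.*2.+2)%N = f i) -> (forall i, E (f i) (f i.+1)) ->
  (forall i, f i.+2 <> f i) ->
  exists z : V,
    [/\ branch z, E z (z + r%:R),
        forall j, (j < q)%N -> E (z + j%:R) (z + j.+1%:R)
      & \prod_(i < q.*2.+2) sigma [set f i; f i.+1] =
        sigma [set z; z + r%:R] * sigma [set z + q%:R; z + q%:R + r%:R]].
Proof.
move=> symE subE sigma1 per Ef nb.
have sigma1' x y : y = x + 1 -> sigma [set y; x] = 1 by move->; rewrite setUC.
have {}sigma1 x y : y = x + 1 -> sigma [set x; y] = 1 by move->.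
have [m [x [e [d [bx e1 d1 f1 f2]]]]] :=
  closed_torus_walk per (fun i => subE _ _ (Ef i)) nb.
have Em j : E (f (m + j)%N) (f (m + j.+1)%N) by rewrite addnS.
have fK : f (m + q.*2.+2)%N = x by rewrite per -[m]addn0 f1 // mulr0 addr0.
rewrite -(prod_periodic (F := fun i => sigma [set f i; f i.+1]) m); last first.
  by move=> i; rewrite -addSn !per.
have Efirst j : (j < q)%N -> E (x + (e * j%:Z)%:~R) (x + (e * j.+1%:Z)%:~R).
  by move=> lt_j; have := Em j; rewrite !f1 // ltnW.
have Emid : E (x + (e * q%:Z)%:~R) (x + (e * q%:Z)%:~R + r%:R * d%:~R).
  by have := Em q; rewrite f1 // -[q.+1]addn0 f2 // subr0.
have Eback j : (j < q)%N -> E (x + (e * (q%:Z - j%:Z))%:~R + r%:R * d%:~R)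
                              (x + (e * (q%:Z - j.+1%:Z))%:~R + r%:R * d%:~R).
  by move=> lt_j; have := Em (q.+1 + j)%N; rewrite -addnS !f2 // ltnW.
have Elast : E (x + r%:R * d%:~R) x.
  have := Em q.*2.+1; rewrite fK (_ : q.*2.+1 = (q.+1 + q)%N); last by lia.
  by rewrite f2 // subrr mulr0 addr0.
have -> : \prod_(i < q.*2.+2) sigma [set f (m + i)%N; f (m + i).+1] =
    sigma [set x + (e * q%:Z)%:~R; x + (e * q%:Z)%:~R + r%:R * d%:~R] *
    sigma [set x + r%:R * d%:~R; x].
  rewrite (big_two_runs _ _ (fun i => sigma [set f (m + i)%N; f (m + i).+1])) /=.
  rewrite big1 ?mul1r => [|[j lt_j] _]; last first.
    rewrite /= -addnS !f1 // ?(ltnW lt_j) //.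
    by case: e1 => ->; [apply: sigma1 | apply: sigma1']; rewrite intS; ring.
  rewrite [X in _ * X * _]big1 ?mulr1 => [|[j lt_j] _]; last first.
    rewrite /= -addnS -addnS !f2 // ?(ltnW lt_j) //.
    by case: e1 => ->; [apply: sigma1' | apply: sigma1]; rewrite intS; ring.
  rewrite f1 // -addnS -[q.+1]addn0 f2 // subr0; congr (_ * sigma [set _; _]).
    by rewrite (_ : q.*2.+1 = (q.+1 + q)%N) ?f2 ?subrr ?mulr0 ?addr0 //; lia.
  by rewrite -addnS fK.
have branchq : branch (x - q%:R).
  by rewrite pmulrn -mulrNz branchD ?abszN.
have branchr y : branch y -> branch (y - r%:R).
  by move=> b_y; rewrite pmulrn -mulrNz branchD ?abszN // dvdn_mulr.
(* The starting vertex [x] may be any of the four corners of the face, according to the signs of [e]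
   and [d]. *)
case: e1 d1 Efirst Emid Eback Elast {f1 f2} => -> [] -> Efirst Emid Eback Elast.
- exists x; split=> //.
  + by rewrite symE; move: Elast; rewrite mulr1.
  + by move=> j /Efirst; rewrite !mul1r.
  + by rewrite mulrC !mul1r mulr1; congr (sigma _ * _); rewrite setUC.
- exists (x - r%:R); split.
  + exact: branchr.
  + by move: Elast; rewrite subrK mulrN mulr1.
  + move=> j lt_j; have := Eback (q - j.+1)%N; rewrite symE !mul1r => H.
    have := H ltac:(lia).
    congr E.
      by rewrite -subSn // subSS; rewrite (_ : q%:Z - (q - j)%N%:Z = j%:Z); [ring | lia].
    by rewrite (_ : q%:Z - (q - j.+1)%N%:Z = j.+1%:Z); [ring | lia].
  + rewrite mulrC subrK mul1r; congr (sigma _ * sigma _).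
      by rewrite mulrN mulr1.
    by rewrite setUC; congr [set _; _]; ring.
- exists (x - q%:R); split.
  + exact: branchq.
  + by move: Emid; congr E; ring.
  + move=> j lt_j; have := Efirst (q - j.+1)%N ltac:(lia); rewrite symE.
    congr E.
      by rewrite -subSn // subSS -subzn ?(ltnW lt_j) //; ring.
    by rewrite -subzn //; ring.
  + congr (sigma _ * sigma _); first by congr [set _; _]; ring.
    by rewrite setUC subrK mulr1.
- exists (x - q%:R - r%:R); split.
  + exact/branchr/branchq.
  + by move: Emid; rewrite symE; congr E; ring.
  + by move=> j /Eback; congr E; ring.
  + congr (sigma _ * sigma _); first by rewrite setUC; congr [set _; _]; ring.
    by congr [set _; _]; ring.
Qed.

(** * Alternating signings and proper subgraphs *)

Lemma set2_eq (T : finType) (a b c d : T) :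
  [set a; b] = [set c; d] -> a = c /\ b = d \/ a = d /\ b = c.
Proof.
move=> E.
have : a \in [set c; d] by rewrite -E set21.
have : b \in [set c; d] by rewrite -E set22.
have : c \in [set a; b] by rewrite E set21.
have : d \in [set a; b] by rewrite E set22.
by rewrite !inE => /orP[]/eqP-> /orP[]/eqP? /orP[]/eqP? /orP[]/eqP?; subst; auto.
Qed.

(* The rank of [x] in [y + q, y + 2q, ..., y], reduced modulo 2: adding [q]
   changes it except at [x = y], where the enumeration wraps around. *)
Definition parity (y x : V) := odd (val (x - (y + q%:R)) %/ q).

(** With [x - (y + q) = k q], adding [q] raises [k] by one, and it wraps around only when
    [k = n - 1], that is, at [x = y]. *)
Lemma parityD (y x : V) :
  branch x -> branch y -> x <> y -> parity y (x + q%:R) = ~~ parity y x.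
Proof.
move=> bx b_y neq_xy; rewrite /parity addrAC; set w := x - (y + _).
have b_w : branch w.
  have := branchD_q b_y; rewrite /w; move: (y + _) => u b_u.
  by move: bx; rewrite -{1}(subrK u x) -{2}(natr_Zp u) branch_natD dvdn_addl.
have [k Ek] := dvdnP b_w; have Ew : w = (k * q)%:R by rewrite -Ek natr_Zp.
have ltk : (k.+1 < n)%N.
  have : (k < n)%N by have := ltn_V w; rewrite Ek (mulnC k) ltn_pmul2l.
  rewrite leq_eqVlt => /predU1P[En|//]; case: neq_xy.
  have : w + q%:R = 0.
    rewrite Ew -natrD addnC -mulSn En (mulnC n); apply: val_inj.
    by rewrite /= val_Zp_nat ?N_gt1 // modnn.
  by rewrite /w opprD addrA subrK => /eqP; rewrite subr_eq0 => /eqP.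
have -> : val (w + q%:R) = (k.+1 * q)%N.
  rewrite Ew -natrD addnC -mulSn /= val_Zp_nat ?N_gt1 // modn_small //.
  by rewrite (mulnC k.+1) ltn_pmul2l.
by rewrite (Ek : val w = _) !mulnK.
Qed.

(** As a set, an edge does not show which end is its base [x], hence the existential. *)
Definition alternating (y : V) (e : {set V}) : int :=
  if [exists x, [&& branch x, parity y x & e == [set x; x + r%:R]]] then -1 else 1.

Lemma alternating_unit y e : alternating y e = 1 \/ alternating y e = -1.
Proof. by rewrite /alternating; case: ifP; auto. Qed.

(** Two possible bases for one edge would give [2 r = 0] modulo [N], but [0 < 2 r < N]. *)
Lemma alternating_horizontal y x :
  branch x -> alternating y [set x; x + r%:R] = if parity y x then -1 else 1.
Proof.
move=> bx; rewrite /alternating; congr (if _ then _ else _).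
apply/existsP/idP => [[z /and3P[_ pz /eqP/set2_eq]]|px]; last first.
  by exists x; rewrite bx px eqxx.
case=> [[-> _] //|[Exz Ezx]].
have : (r * 2)%:Z%:~R = 0 :> V.
  rewrite -pmulrn (natrM _ r) (_ : _ * _ = z + r%:R + r%:R - z); last by ring.
  by rewrite -Exz Ezx subrr.
have rpos : (0 < r)%N by rewrite muln_gt0 q_gt0 (leq_ltn_trans _ t_big).
by move/intZ_eq0; have := n_le_N; move: n_big; nia.
Qed.

(** A vertical edge could be read as a horizontal one only if [r] were 1 or -1 modulo [N]. *)
Lemma alternating_vertical y x : alternating y [set x; x + 1] = 1.
Proof.
rewrite /alternating; case: existsP => // -[z /and3P[_ _ /eqP/set2_eq E]].
have r_gt1 : (1 < r)%N by move: q_gt0 t_big; nia.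
have big := r_lt_N; have n1 := n_le_N.
case: E => [[<- /addrI E]|[Ex Ez]].
  have /intZ_eq0 : (r%:Z - 1)%:~R = 0 :> V by rewrite intrD -pmulrn -E; ring.
  by lia.
have /intZ_eq0 : (r%:Z + 1)%:~R = 0 :> V.
  rewrite intrD -pmulrn; apply: (addrI z); rewrite addr0 -[RHS]Ez Ex; ring.
by move: n_big; nia.
Qed.

Lemma alternating_face y z : branch z -> branch y -> z <> y ->
  alternating y [set z; z + r%:R] * alternating y [set z + q%:R; z + q%:R + r%:R] = -1.
Proof.
move=> bz b_y neq; rewrite !alternating_horizontal ?branchD_q // parityD //.
by case: parity.
Qed.

(** The edges of the torus split into pieces, one for each branch vertex [y]: the edge from [y] to
    [y + r] and the path from [y] to [y + q]. A proper subgraph misses an edge of some piece, hence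
    lacks the face with corner [y], the only one that [alternating y] may leave balanced. *)
Lemma torus_subgraph_family_A (S : subgraph torus) :
  proper_subgraph S -> family_A q.*2.+2 S.
Proof.
move=> properS.
have [y [b_y miss]] : exists y : V, branch y /\
    (sub_adj S y (y + r%:R) ->
     ~ (forall j, (j < q)%N -> sub_adj S (y + j%:R) (y + j.+1%:R))).
  apply: NNPP => none.
  have dense (y : V) : branch y -> sub_adj S y (y + r%:R) /\
      (forall j, (j < q)%N -> sub_adj S (y + j%:R) (y + j.+1%:R)).
    move=> b_y; apply: NNPP => H; apply: none; exists y; split=> //.
    by move=> H1 H2; apply: H.
  have vert (x : V) : sub_adj S x (x + 1).
    (* [y] is the branch vertex whose piece contains the edge from [x] to [x + 1]. *)
    pose j := (x %% q)%N; pose y := x - j%:R.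
    have Ex : x = y + j%:R by rewrite subrK.
    have b_y : branch y.
      have -> : y = (x %/ q * q)%N%:R.
        by rewrite /y -{1}(natr_Zp x) {1}(divn_eq x q) natrD addrK.
      by rewrite /branch val_Zp_nat ?N_gt1 // /dvdn modn_dvdm ?dvdn_mulr // modnMl.
    have [_ /(_ j)] := dense y b_y; rewrite ltn_pmod // => /(_ isT).
    by rewrite -Ex (_ : y + j.+1%:R = x + 1) // [in RHS]Ex; ring.
  have full : subrel (@adj torus) (sub_adj S).
    move=> x z; rewrite /= /torus_rel => /or4P[]; [move/eqP->|move/eqP->| |].
    - exact: vert.
    - by rewrite sub_adj_sym vert.
    - by case/andP=> bx /eqP->; case: (dense x bx).
    - by case/andP=> bz /eqP->; rewrite sub_adj_sym; case: (dense z bz).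
  apply: properS; split.
    by apply/setP => x; rewrite inE (sub_adj_verts (vert x)).
  by move=> x z; apply/idP/idP; [apply: sub_adj_incl | apply: full].
pose vl (x : S) : V := sval x.
exists (fun e : {set S} => alternating y (vl @: e)); split.
  by move=> e _; apply: alternating_unit.
move=> c [size_c /andP[cyc_c uniq_c]].
have c0 : (0 < size c)%N by rewrite size_c.
have [x0 _] : exists x, x \in c by case: (c) c0 => // x ? _; exists x; rewrite mem_head.
(* The cycle of [S] unrolled into a periodic walk on the torus. *)
pose f i := vl (nth x0 c (i %% q.*2.+2)).
have per i : f (i + q.*2.+2)%N = f i by rewrite /f modnDr.
have fS i : f i.+1 = vl (nth x0 c ((i %% q.*2.+2).+1 %% q.*2.+2)).
  by rewrite /f -(addn1 i) -modnDml addn1.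
have Ef i : sub_adj S (f i) (f i.+1).
  rewrite fS /f; move/(cycle_nthP _ x0): cyc_c => /(_ (i %% q.*2.+2)%N).
  by rewrite size_c ltn_pmod //; apply.
have nb i : f i.+2 <> f i.
  move=> /val_inj/eqP; rewrite nth_uniq ?size_c ?ltn_pmod //.
  rewrite -addn2 -[X in _ == X %[mod _]]addn0 eqn_modDl mod0n modn_small //.
  by move: q_gt0; lia.
have [z [bz Ez1 Ez2 Eprod]] := closed_torus_walk_face (sigma := alternating y)
  (@sub_adj_sym _ S) (@sub_adj_incl _ S) (alternating_vertical y) per Ef nb.
rewrite /unbalanced (cycle_sign_nth _ x0) // size_c.
rewrite -(alternating_face bz b_y) => [|Ezy]; last by subst z; exact: miss.
rewrite -Eprod; apply: eq_bigr => i _; rewrite imsetU1 imset_set1.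
by rewrite fS /f (modn_small (ltn_ord i)).
Qed.

(** * Faces and the parity obstruction *)

(* Meaningful for [i <= q.*2.+1]. *)
Definition face (x : V) (i : nat) : V :=
  x + (if (i <= q)%N then i%:Z else r%:Z + (q.*2.+1 - i)%N%:Z)%:~R.

Lemma face_cycle x :
  branch x -> is_cycle (G := torus) q.*2.+2 (mkseq (face x) q.*2.+2).
Proof.
move=> bx; split; rewrite ?size_mkseq //; apply/andP; split.
  apply/(cycle_nthP _ x) => i; rewrite size_mkseq => lt_i.
  rewrite !nth_mkseq ?ltn_pmod // /face /= /torus_rel.
  have [lt_iq|ltqi|->] := ltngtP i q.
  - rewrite modn_small; last lia.
    by rewrite lt_iq intS; apply/or4P/Or41; apply/eqP; ring.
  - have [lt_iK|] := ltnP i.+1 q.*2.+2.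
      rewrite modn_small // ifF; last lia.
      apply/or4P/Or42; apply/eqP.
      rewrite (_ : q.*2.+1 - i = (q.*2.+1 - i.+1).+1)%N; last lia.
      by rewrite intS; ring.
    move=> le_Ki; have -> : i = q.*2.+1 by lia.
    rewrite modnn /= subnn.
    by apply/or4P/Or44; rewrite -pmulrn mulr0n !addr0 bx -pmulrn eqxx.
  - rewrite modn_small; last lia.
    rewrite ltnn (_ : q.*2.+1 - q.+1 = q)%N; last lia.
    apply/or4P/Or43; rewrite intrD -!pmulrn branchD_q //=; apply/eqP; ring.
(* The displacements from [x] are distinct integers in [[0, q]] and [[r, r + q]], all below [N]. *)
rewrite map_inj_in_uniq ?iota_uniq // => i j; rewrite !mem_iota /= => lt_i lt_j.
move/addrI/eqP; rewrite -subr_eq0 -intrB => /eqP/intZ_eq0.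
have lt_N := n_le_N; have q_r : (q.*2 < r)%N by move: t_big q_gt0; nia.
have lt_rN : (q.*2.+2 + r < N)%N by apply: leq_trans lt_N; move: n_big; nia.
by case: ifP; case: ifP; lia.
Qed.

(** Both paths are read upwards, so that the factors are translates of two functions of a branch
    vertex, ready for the product over all faces. *)
Lemma face_sign (sigma : {set V} -> int) x :
  branch x ->
  cycle_sign (G := torus) sigma (mkseq (face x) q.*2.+2) =
    (\prod_(i < q) sigma [set x + i%:R; x + i.+1%:R]) *
    (\prod_(i < q) sigma [set x + r%:R + i%:R; x + r%:R + i.+1%:R]) *
    (sigma [set x; x + r%:R] * sigma [set x + q%:R; x + q%:R + r%:R]).
Proof.
move=> bx; have [_ /andP[_ uniq_c]] := face_cycle bx.
rewrite (@cycle_sign_nth torus _ x) // size_mkseq.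
rewrite (eq_bigr (fun i : 'I_q.*2.+2 =>
   sigma [set face x i; face x (i.+1 %% q.*2.+2)%N])); last first.
  by move=> i _; rewrite !nth_mkseq ?ltn_pmod.
rewrite (big_two_runs _ _
  (fun i => sigma [set face x i; face x (i.+1 %% q.*2.+2)%N])) /=.
rewrite (eq_bigr (fun i : 'I_q => sigma [set x + i%:R; x + i.+1%:R])); last first.
  move=> [i lt_i] _; rewrite /= modn_small; last lia.
  by rewrite /face lt_i ltnW // !pmulrn.
(* The face runs down its second path; [rev_ord] restores the upward order. *)
rewrite [X in _ * (_ * X) * _](eq_bigr (fun i : 'I_q =>
  sigma [set x + r%:R + (rev_ord i)%:R; x + r%:R + (rev_ord i).+1%:R])); last first.
  move=> [i lt_i] _; rewrite /= modn_small; last lia.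
  rewrite /face !ifF; try lia.
  rewrite setUC (_ : q.*2.+1 - (q.+1 + i) = (q - i.+1).+1)%N; last lia.
  rewrite (_ : q.*2.+1 - (q.+1 + i).+1 = q - i.+1)%N; last lia.
  by rewrite !intrD -!pmulrn !addrA.
rewrite [X in _ * (_ * X) * _](reindex_inj rev_ord_inj) /=.
rewrite [X in _ * (_ * X) * _](eq_bigr (fun i : 'I_q =>
  sigma [set x + r%:R + i%:R; x + r%:R + i.+1%:R])); last first.
  by move=> i _; rewrite -[(q - (q - i.+1).+1)%N]/(val (rev_ord (rev_ord i))) rev_ordK.
have -> : [set face x q; face x (q.+1 %% q.*2.+2)] = [set x + q%:R; x + q%:R + r%:R].
  rewrite modn_small; last lia.
  rewrite /face leqnn ltnn (_ : q.*2.+1 - q.+1 = q)%N; last lia.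
  by congr [set _; _]; rewrite ?intrD -!pmulrn //; ring.
have -> : [set face x q.*2.+1; face x (q.*2.+2 %% q.*2.+2)] = [set x; x + r%:R].
  rewrite modnn /face /= ifF; last lia.
  by rewrite subnn -pmulrn mulr0n !addr0 setUC -pmulrn.
ring.
Qed.

Lemma card_branch : #|branch| = n.
Proof.
have lt_qN (i : 'I_n) : (q * i < N)%N by rewrite ltn_pmul2l.
pose g (i : 'I_n) : V := (q * i)%:R.
have val_g i : nat_of_ord (g i) = (q * i)%N.
  by rewrite val_Zp_nat ?N_gt1 // modn_small.
have g_inj : injective g.
  move=> i j /(congr1 (fun v : V => nat_of_ord v)); rewrite !val_g => /eqP.
  by rewrite eqn_pmul2l // => /eqP/val_inj.
rewrite -[RHS]card_ord -(card_image g_inj); apply: eq_card => x.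
apply/idP/imageP => [/dvdnP[k Ek]|[i _ ->]]; last first.
  by rewrite -topredE /= /branch val_g dvdn_mulr.
have lt_kn : (k < n)%N by rewrite -(ltn_pmul2l q_gt0) mulnC -Ek ltn_V.
exists (Ordinal lt_kn) => //; apply: val_inj.
by apply: (etrans Ek); rewrite (mulnC k) -(val_g (Ordinal lt_kn)).
Qed.

Lemma torus_not_family_A : odd n -> ~ family_A q.*2.+2 torus.
Proof.
move=> n_odd [sigma [unit_sigma unb]].
have sq x y : torus_rel x y -> sigma [set x; y] ^+ 2 = 1.
  move=> xy; have /unit_sigma : [set x; y] \in edges torus.
    rewrite inE; apply/existsP; exists x; apply/existsP; exists y.
    by rewrite /= xy eqxx.
  by case=> ->.
pose P (x : V) := \prod_(i < q) sigma [set x + i%:R; x + i.+1%:R].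
pose H (x : V) := sigma [set x; x + r%:R].
have : \prod_(x | branch x) (P x * P (x + r%:R) * (H x * H (x + q%:R))) =
       \prod_(x | branch x) (-1).
  by apply: eq_bigr => x bx; rewrite -face_sign // unb //; apply: face_cycle.
(* Translation by a multiple of [q] permutes the branch vertices, so every sign ends up squared in
   the product of all faces. *)
have shift (F : V -> int) m : (q %| m)%N ->
    \prod_(x | branch x) F (x + m%:R) = \prod_(x | branch x) F x.
  move=> qm; rewrite [RHS](reindex_inj (addIr m%:R)) /=.
  by apply: eq_bigl => x; rewrite branch_natD dvdn_addl.
rewrite prodr_const card_branch -signr_odd n_odd !big_split /=.
rewrite (shift P) ?dvdn_mulr // (shift H) // -!expr2 -!prodrXl !big1 //.
- move=> x bx; rewrite /H sq // /torus_rel bx eqxx /= !orbT //.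
- move=> x _; rewrite /P -prodrXl big1 // => i _; rewrite sq //.
  by rewrite /torus_rel -natr1 addrA eqxx.
Qed.

Lemma torus_family_B : odd n -> family_B q.*2.+2 torus.
Proof.
by split; [exact: torus_not_family_A | exact: torus_subgraph_family_A].
Qed.

Lemma card_torus : #|torus| = N.
Proof. by rewrite card_ord Zp_cast // N_gt1. Qed.

End Torus.
Local Close Scope ring_scope.

(** * Infinitely many minimal obstructions *)

Lemma infinite_family_B q : 0 < q -> infinite_family (family_B q.*2.+2).
Proof.
move=> q_gt0; pose t := q.*2.+3.
(* Odd, above the required bound, and strictly increasing in [i], so that the tori have different
   orders. *)
pose n i := (q.*2.+2 * (q * t).+1 + i).*2.+1.
have t_big : q.*2.+2 < t by [].
have n_odd i : odd (n i) by rewrite /n /= odd_double.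
have n_big i : q.*2.+2 * (q * t).+1 < n i by rewrite /n; lia.
exists (fun i => torus q_gt0 t_big (n_big i)); split=> [i|i j neq_ij [f [bij_f _]]].
  exact: torus_family_B.
apply: neq_ij; have := bij_eq_card bij_f.
rewrite !card_torus // => /eqP; rewrite eqn_pmul2l // /n => /eqP; lia.
Qed.

Theorem corollary2p5 (k : nat) (hk : 2 <= k) :
  infinite_family (family_B (2 * k)) /\
  ~ (exists F : graph_family,
       finite_family F /\
       forall G : sgraph, family_A (2 * k) G <-> Forb F G).
Proof.
have inf_B : infinite_family (family_B (2 * k)).
  by rewrite (_ : 2 * k = k.-1.*2.+2); [apply: infinite_family_B | ]; lia.
by split=> // -[F [finF AF]]; apply: infinite_not_Forb inf_B finF AF.
Qed.
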